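(* Let $q\in\mathbb{C}$ with $0<|q|<1$, let $n\ge 0$ be an integer, let $a,b$ be positive integers with $a\equiv 1\pmod 2$ and $b\equiv 1\pmod 2$, and let $x\in\mathbb{C}$. Then $$[2]_{q^b}\,[a]_q^n\sum_{j=0}^{a-1}(-1)^jq^{bj}E_{n,q^a}\!\left(bx+\frac{bj}{a}\right)=[2]_{q^a}\,[b]_q^n\sum_{j=0}^{b-1}(-1)^jq^{aj}E_{n,q^b}\!\left(ax+\frac{aj}{b}\right).$$
   Context: Fix $\lambda\in\mathbb{C}$ with $e^{\lambda}=q$, and for $y\in\mathbb{C}$ put $q^y=e^{\lambda y}$. For a positive integer $c$, powers of the base $q^c$ are $(q^c)^y=q^{cy}=e^{c\lambda y}$. The $q$-analogue of $y\in\mathbb{C}$ is $[y]_q=\frac{1-q^y}{1-q}$, and for the base $q^c$ it is $[y]_{q^c}=\frac{1-q^{cy}}{1-q^c}$; in particular $[2]_{q^c}=1+q^c$. The $q$-Euler polynomials $E_{n,q}(y)$, $n\ge 0$, are defined by the generating function $$[2]_q\sum_{m=0}^{\infty}(-1)^mq^m e^{[m+y]_q t}=\sum_{n=0}^{\infty}E_{n,q}(y)\frac{t^n}{n!},$$ and $E_{n,q^c}(y)$ denotes the same object with $q$ replaced by $q^c$ throughout (using $(q^c)^y=q^{cy}$). The convention $0^0=1$ is used. *)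

(* Defs.v *)
From Stdlib Require Import Reals Arith Factorial ClassicalEpsilon.
From Coquelicot Require Export Coquelicot.

Local Open Scope C_scope.

Definition NtoC (n : nat) : C := RtoC (INR n).

Definition Cexp (z : C) : C :=
  ((exp (Re z) * cos (Im z))%R, (exp (Re z) * sin (Im z))%R).

(* A base is represented by the chosen logarithm [mu], the base itself being
   [Cexp mu].  With [q = Cexp lam], the base [q^c] is represented by [c * lam],
   which gives (q^c)^y = e^(c * lam * y). *)
Definition qpow (mu y : C) : C := Cexp (mu * y).

Definition qnum (mu y : C) : C := (1 - qpow mu y) / (1 - Cexp mu).

(* [E] is the sequence of coefficients in the generating function identity
     [2]_q sum_m (-1)^m q^m e^([m+y]_q t) = sum_n E_n t^n / n!,
   where q = e^mu; both sides are entire in t when |q| < 1. *)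
Definition is_qEuler (mu y : C) (E : nat -> C) : Prop :=
  forall t : C, exists S : C,
    is_series (fun m : nat =>
      (- (1)) ^ m * qpow mu (NtoC m) * Cexp (qnum mu (NtoC m + y) * t)) S /\
    is_series (fun n : nat => E n * (t ^ n / NtoC (fact n))) (qnum mu 2 * S).

(* E_{n,q}(y) for q = e^mu: when |q| < 1, the identity in [is_qEuler] is
   satisfied by exactly one sequence. *)
Definition qEuler (mu : C) (n : nat) (y : C) : C :=
  epsilon (inhabits (fun _ : nat => RtoC 0)) (is_qEuler mu y) n.

(* Main.v *)
Require Import Defs.
From Stdlib Require Import Reals Arith Lra Lia Factorial ClassicalEpsilon.
From Coquelicot Require Import Coquelicot.
Local Open Scope C_scope.

(** Expanding [e^([m+y]_q t)] in the generating function and exchanging the two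
    summations gives E_{n,q}(y) = [2]_q sum_m (-1)^m q^m [m+y]_q^n, the
    coefficients of an everywhere convergent power series being unique.  Since
    [a]_q [y]_{q^a} = [a y]_q, the left-hand side becomes
    [2]_{q^a} [2]_{q^b} sum_{j<a} sum_m (-1)^(j+m) q^(am+bj) [abx+am+bj]_q^n.
    Writing m = b i + l with l < b, where (-1)^(b i) = (-1)^i as b is odd, turns
    this into a triple sum that is symmetric in (a, j) and (b, l). *)

(* [ring] does not recognise equations typed in the carrier of a canonical
   structure on [C]. *)
Ltac C_ring := match goal with |- @eq _ ?u ?v => change (@eq C u v) end; ring.

(** * The complex exponential and its modulus *)

Lemma Cexp_plus (z w : C) : Cexp (z + w) = Cexp z * Cexp w.
Proof.
  destruct z as [a b], w as [c d]; unfold Cexp, Cmult, Cplus, Re, Im; simpl.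
  rewrite exp_plus, cos_plus, sin_plus; apply injective_projections; simpl; ring.
Qed.

Lemma Cexp_0 : Cexp 0 = 1.
Proof.
  unfold Cexp; simpl; rewrite exp_0, cos_0, sin_0.
  apply injective_projections; simpl; ring.
Qed.

Lemma Cmod_Cexp (z : C) : Cmod (Cexp z) = exp (Re z).
Proof.
  unfold Cmod, Cexp; simpl fst; simpl snd.
  replace ((exp (Re z) * cos (Im z)) ^ 2 + (exp (Re z) * sin (Im z)) ^ 2)%R
    with (Rsqr (exp (Re z)))%R.
  - apply sqrt_Rsqr; left; apply exp_pos.
  - pose proof (sin2_cos2 (Im z)) as H; unfold Rsqr in *.
    transitivity (exp (Re z) * exp (Re z) * (sin (Im z) * sin (Im z) + cos (Im z) * cos (Im z)))%R;
      [rewrite H|]; ring.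
Qed.

Lemma im_le_Cmod (z : C) : (Rabs (Im z) <= Cmod z)%R.
Proof. eapply Rle_trans; [apply Rmax_r|apply (Rmax_Cmod z)]. Qed.

Lemma Cmod_le_Re_Im (z : C) : (Cmod z <= Rabs (Re z) + Rabs (Im z))%R.
Proof.
  replace z with (RtoC (Re z) + Ci * RtoC (Im z)) at 1
    by (apply injective_projections; simpl; unfold Re, Im; ring).
  eapply Rle_trans; [apply Cmod_triangle|].
  rewrite Cmod_mult, !Cmod_R, Cmod_Ci; lra.
Qed.

Lemma Cmod_Cexp_le (z : C) : (Cmod (Cexp z) <= exp (Cmod z))%R.
Proof.
  rewrite Cmod_Cexp; destruct (Rle_lt_or_eq_dec (Re z) (Cmod z)) as [H|H].
  - eapply Rle_trans; [apply Rle_abs|apply re_le_Cmod].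
  - left; now apply exp_increasing.
  - rewrite H; lra.
Qed.

(** * Componentwise derivatives of complex functions of a real variable *)

Definition is_Cderive (f : R -> C) (s : R) (l : C) : Prop :=
  is_derive (fun u => Re (f u)) s (Re l) /\ is_derive (fun u => Im (f u)) s (Im l).

(** The Taylor estimate is carried out along the segment from 0 to [w], so derivatives in a real
    parameter suffice. *)
Lemma is_Cderive_Cexp (w : C) (s : R) :
  is_Cderive (fun u => Cexp (w * RtoC u)) s (w * Cexp (w * RtoC s)).
Proof.
  destruct w as [a b]; split; unfold Cexp, Re, Im, RtoC; simpl.
  all: auto_derive; [easy|]; unfold Rminus; ring.
Qed.

Definition Cexp_poly (N : nat) (z : C) : C :=
  sum_n (fun k => z ^ k / NtoC (fact k)) N.

Lemma NtoC_neq_0 (n : nat) : n <> 0%nat -> NtoC n <> 0.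
Proof. intros Hn H; apply (not_0_INR n Hn); now injection H. Qed.

Lemma NtoC_fact_S (n : nat) : NtoC (fact (S n)) = NtoC (S n) * NtoC (fact n).
Proof.
  unfold NtoC; rewrite <- RtoC_mult, <- mult_INR; reflexivity.
Qed.

Lemma Cexp_poly_S (N : nat) (z : C) :
  Cexp_poly (S N) z = Cexp_poly N z + z ^ (S N) / NtoC (fact (S N)).
Proof. unfold Cexp_poly; rewrite sum_Sn; reflexivity. Qed.

Lemma is_Cderive_plus (f g : R -> C) (s : R) (lf lg : C) :
  is_Cderive f s lf -> is_Cderive g s lg ->
  is_Cderive (fun u => f u + g u) s (lf + lg).
Proof.
  intros [F1 F2] [G1 G2]; split.
  - exact (is_derive_plus _ _ _ _ _ F1 G1).
  - exact (is_derive_plus _ _ _ _ _ F2 G2).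
Qed.

Lemma is_Cderive_minus (f g : R -> C) (s : R) (lf lg : C) :
  is_Cderive f s lf -> is_Cderive g s lg ->
  is_Cderive (fun u => f u - g u) s (lf - lg).
Proof.
  intros [F1 F2] [G1 G2]; split.
  - exact (is_derive_minus _ _ _ _ _ F1 G1).
  - exact (is_derive_minus _ _ _ _ _ F2 G2).
Qed.

Lemma Re_mult_RtoC (v : C) (u : R) : Re (v * RtoC u) = (Re v * u)%R.
Proof. destruct v; simpl; ring. Qed.

Lemma Im_mult_RtoC (v : C) (u : R) : Im (v * RtoC u) = (Im v * u)%R.
Proof. destruct v; simpl; ring. Qed.

Lemma is_Cderive_monomial (c : C) (n : nat) (s : R) :
  is_Cderive (fun u => c * RtoC u ^ (S n)) s (c * (NtoC (S n) * RtoC s ^ n)).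
Proof.
  unfold NtoC; rewrite <- RtoC_pow, <- RtoC_mult; split.
  - rewrite Re_mult_RtoC.
    apply (is_derive_ext (fun u => Re c * u ^ (S n))%R).
    { intros u; now rewrite <- RtoC_pow, Re_mult_RtoC. }
    auto_derive; [easy|]. change (Re c * (1 * (INR (S n) * s ^ n)) = Re c * (INR (S n) * s ^ n))%R; ring.
  - rewrite Im_mult_RtoC.
    apply (is_derive_ext (fun u => Im c * u ^ (S n))%R).
    { intros u; now rewrite <- RtoC_pow, Im_mult_RtoC. }
    auto_derive; [easy|]. change (Im c * (1 * (INR (S n) * s ^ n)) = Im c * (INR (S n) * s ^ n))%R; ring.
Qed.

Lemma is_Cderive_const (c : C) (s : R) : is_Cderive (fun _ => c) s 0.
Proof. split; apply (is_derive_const (V := R_NormedModule)). Qed.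

Lemma is_Cderive_ext (f g : R -> C) (s : R) (l : C) :
  (forall u, f u = g u) -> is_Cderive f s l -> is_Cderive g s l.
Proof.
  intros H [F1 F2]; split.
  - refine (is_derive_ext _ _ _ _ _ F1); intros u; now rewrite H.
  - refine (is_derive_ext _ _ _ _ _ F2); intros u; now rewrite H.
Qed.

Lemma Cexp_poly_0 (z : C) : Cexp_poly 0 z = 1.
Proof.
  unfold Cexp_poly; rewrite sum_O; simpl.
  apply injective_projections; simpl; field.
Qed.

(** Differentiation lowers the degree by one while it reproduces the exponential up to the factor
    [w]. Hence the remainder of order [S N] has derivative [w] times the remainder of order [N],
    which drives the induction for the Taylor bound. *)
Lemma is_Cderive_Cexp_poly (N : nat) (w : C) (s : R) :
  is_Cderive (fun u => Cexp_poly (S N) (w * RtoC u)) s (w * Cexp_poly N (w * RtoC s)).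
Proof.
  assert (Hm : forall n, is_Cderive
    (fun u => (w * RtoC u) ^ (S n) / NtoC (fact (S n))) s
    (w * ((w * RtoC s) ^ n / NtoC (fact n)))).
  { intros n.
    apply (is_Cderive_ext (fun u => w ^ (S n) / NtoC (fact (S n)) * RtoC u ^ (S n))).
    { intros u; rewrite Cpow_mult_l; unfold Cdiv; ring. }
    replace (w * ((w * RtoC s) ^ n / NtoC (fact n)))
      with (w ^ S n / NtoC (fact (S n)) * (NtoC (S n) * RtoC s ^ n)).
    { apply is_Cderive_monomial. }
    rewrite Cpow_mult_l, NtoC_fact_S; simpl Cpow; field; split; apply NtoC_neq_0;
      [apply fact_neq_0|easy]. }
  induction N as [|N IH].
  - apply (is_Cderive_ext (fun u => Cexp_poly 0 (w * RtoC u) + (w * RtoC u) ^ 1 / NtoC (fact 1))).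
    { intros u; now rewrite <- Cexp_poly_S. }
    replace (w * Cexp_poly 0 (w * RtoC s)) with (0 + w * Cexp_poly 0 (w * RtoC s)) by ring.
    apply is_Cderive_plus.
    + apply (is_Cderive_ext (fun _ => 1)); [|apply is_Cderive_const].
      intros u; now rewrite Cexp_poly_0.
    + pose proof (Hm 0%nat) as H; rewrite Cexp_poly_0.
      replace ((w * RtoC s) ^ 0 / NtoC (fact 0)) with (RtoC 1) in H; [exact H|].
      simpl; apply injective_projections; simpl; field.
  - apply (is_Cderive_ext (fun u => Cexp_poly (S N) (w * RtoC u)
       + (w * RtoC u) ^ (S (S N)) / NtoC (fact (S (S N))))).
    { intros u; now rewrite <- Cexp_poly_S. }
    rewrite Cexp_poly_S, Cmult_plus_distr_l.
    now apply is_Cderive_plus.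
Qed.

(** * Taylor remainder of the complex exponential *)

(** The mean value theorem for [h - g] on [[0, s]] gives a nonnegative increment. *)
Lemma le_of_derive_le (g h dg dh : R -> R) (s : R) :
  (0 <= s)%R -> g 0%R = h 0%R ->
  (forall u, is_derive g u (dg u)) -> (forall u, is_derive h u (dh u)) ->
  (forall u, 0 <= u <= s -> dg u <= dh u)%R -> (g s <= h s)%R.
Proof.
  intros Hs H0 Hg Hh Hle.
  assert (Hd : forall u, is_derive (fun v => h v - g v)%R u (dh u - dg u)%R)
    by (intros u; exact (is_derive_minus _ _ _ _ _ (Hh u) (Hg u))).
  destruct (MVT_gen (fun v => h v - g v)%R 0 s (fun u => dh u - dg u)%R) as [c [Hc E]].
  - intros u _; apply Hd.
  - intros u _; apply continuity_pt_filterlim.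
    apply (ex_derive_continuous (fun v => h v - g v)%R); eexists; apply Hd.
  - rewrite Rmin_left, Rmax_right in Hc by lra.
    specialize (Hle c Hc); simpl in E; nra.
Qed.

(** Integrates a bound on a derivative without any integral, by comparing [g] with both [h] and
    [- h]. *)
Lemma abs_le_of_derive_le (g h dg dh : R -> R) (s : R) :
  (0 <= s)%R -> g 0%R = 0%R -> h 0%R = 0%R ->
  (forall u, is_derive g u (dg u)) -> (forall u, is_derive h u (dh u)) ->
  (forall u, 0 <= u <= s -> Rabs (dg u) <= dh u)%R -> (Rabs (g s) <= h s)%R.
Proof.
  intros Hs G0 H0 Hg Hh Hle; apply Rabs_le.
  assert (Hn : forall u, is_derive (fun v => - h v)%R u (- dh u)%R)
    by (intros u; exact (is_derive_opp _ _ _ (Hh u))).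
  split.
  - apply (le_of_derive_le (fun v => - h v)%R g (fun v => - dh v)%R dg); auto.
    + rewrite G0, H0; ring.
    + intros u Hu; specialize (Hle u Hu); apply Rabs_le_between in Hle; lra.
  - apply (le_of_derive_le g h dg dh); auto; [congruence|].
    intros u Hu; specialize (Hle u Hu); apply Rabs_le_between in Hle; lra.
Qed.

(* Estimating the real and imaginary parts separately costs a factor 2 at each
   integration, hence [2 * Cmod w]. *)
Lemma Cderive_remainder_step (w : C) (K : R) (N : nat) (Q F : R -> C) :
  F 0%R = 0 -> (forall u, is_Cderive F u (w * Q u)) ->
  (forall u, 0 <= u <= 1 -> Cmod (Q u) <= 2 * (K * (2 * Cmod w * u) ^ N / INR (fact N)))%R ->
  (forall u, 0 <= u <= 1 -> Cmod (F u) <= 2 * (K * (2 * Cmod w * u) ^ S N / INR (fact (S N))))%R.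
Proof.
  intros F0 HF HQ s Hs.
  (* [h] is half of the claimed bound, one half for each component. Its derivative [dh] is exactly
     [Cmod w] times the bound assumed for [Q]. *)
  set (h := fun u => (K * (2 * Cmod w * u) ^ S N / INR (fact (S N)))%R).
  set (dh := fun u => (Cmod w * (2 * (K * (2 * Cmod w * u) ^ N / INR (fact N))))%R).
  assert (Hh : forall u, is_derive h u (dh u)).
  { intros u; unfold h, dh; auto_derive; [easy|].
    change (fact N + N * fact N)%nat with (fact (S N)).
    change (match N with 0%nat => 1%R | S _ => (INR N + 1)%R end) with (INR (S N)).
    rewrite fact_simpl, mult_INR; simpl pred.
    field; split; [apply INR_fact_neq_0|apply not_0_INR; easy]. }
  assert (H0 : h 0%R = 0%R).
  { unfold h; rewrite Rmult_0_r, pow_i by lia; unfold Rdiv; ring. }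
  assert (Hb : forall u, (0 <= u <= s)%R -> (Cmod (w * Q u) <= dh u)%R).
  { intros u Hu; rewrite Cmod_mult; unfold dh.
    apply Rmult_le_compat_l; [apply Cmod_ge_0|apply HQ; lra]. }
  eapply Rle_trans; [apply Cmod_le_Re_Im|].
  replace (2 * (K * (2 * Cmod w * s) ^ S N / INR (fact (S N))))%R with (h s + h s)%R
    by (unfold h; ring).
  apply Rplus_le_compat.
  - apply (abs_le_of_derive_le (fun u => Re (F u)) h (fun u => Re (w * Q u)) dh); auto.
    + apply Hs.
    + cbv beta; now rewrite F0.
    + intros u; apply HF.
    + intros u Hu; eapply Rle_trans; [apply re_le_Cmod|now apply Hb].
  - apply (abs_le_of_derive_le (fun u => Im (F u)) h (fun u => Im (w * Q u)) dh); auto.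
    + apply Hs.
    + cbv beta; now rewrite F0.
    + intros u; apply HF.
    + intros u Hu; eapply Rle_trans; [apply im_le_Cmod|now apply Hb].
Qed.

Lemma Cexp_poly_at_0 (N : nat) : Cexp_poly N 0 = 1.
Proof.
  induction N as [|N IH]; [apply Cexp_poly_0|].
  rewrite Cexp_poly_S, IH, Cpow_S; unfold Cdiv; ring.
Qed.

(** Induction on [N]: each order is obtained by integrating the bound for the previous one along the
    segment, and the claim is the value at [u = 1]. *)
Lemma Cexp_Taylor_bound (N : nat) (w : C) :
  (Cmod (Cexp w - Cexp_poly N w) <=
     2 * (exp (Cmod w) * (2 * Cmod w) ^ S N / INR (fact (S N))))%R.
Proof.
  enough (H : forall u, (0 <= u <= 1)%R ->
    (Cmod (Cexp (w * RtoC u) - Cexp_poly N (w * RtoC u)) <=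
     2 * (exp (Cmod w) * (2 * Cmod w * u) ^ S N / INR (fact (S N))))%R).
  { specialize (H 1%R ltac:(lra)); now rewrite Cmult_1_r, Rmult_1_r in H. }
  assert (Hz : forall M, Cexp (w * RtoC 0) - Cexp_poly M (w * RtoC 0) = 0).
  { intros M; rewrite Cmult_0_r, Cexp_0, Cexp_poly_at_0; ring. }
  induction N as [|N IH].
  (* At order 0 the role of [Q] is played by the exponential itself, bounded by [exp (Cmod w)] on
     the segment; the factor 2 is slack here. *)
  - apply (Cderive_remainder_step w _ 0 (fun u => Cexp (w * RtoC u))).
    + apply Hz.
    + intros u; replace (w * Cexp (w * RtoC u)) with (w * Cexp (w * RtoC u) - 0) by ring.
      apply is_Cderive_minus; [apply is_Cderive_Cexp|].
      apply (is_Cderive_ext (fun _ => 1)); [|apply is_Cderive_const].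
      intros v; now rewrite Cexp_poly_0.
    + intros u Hu; eapply Rle_trans; [apply Cmod_Cexp_le|].
      assert (Hm : (Cmod (w * RtoC u) <= Cmod w)%R).
      { rewrite Cmod_mult, Cmod_R, Rabs_pos_eq by lra.
        pose proof (Cmod_ge_0 w); nra. }
      assert (He : (exp (Cmod (w * RtoC u)) <= exp (Cmod w))%R).
      { destruct Hm as [Hm|Hm]; [left; now apply exp_increasing|rewrite Hm; lra]. }
      pose proof (exp_pos (Cmod w)); simpl; lra.
  - apply (Cderive_remainder_step w _ (S N)
      (fun u => Cexp (w * RtoC u) - Cexp_poly N (w * RtoC u))).
    + apply Hz.
    + intros u; replace (w * (Cexp (w * RtoC u) - Cexp_poly N (w * RtoC u)))
        with (w * Cexp (w * RtoC u) - w * Cexp_poly N (w * RtoC u)) by ring.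
      apply is_Cderive_minus; [apply is_Cderive_Cexp|apply is_Cderive_Cexp_poly].
    + exact IH.
Qed.

(** The Taylor bound increases with [Cmod w], so it holds uniformly on the disc of radius [r]. *)
Lemma Cexp_poly_approx_bound (N : nat) (r : R) (w : C) : (Cmod w <= r)%R ->
  (Cmod (Cexp w - Cexp_poly N w) <=
     2 * (exp r * (2 * r) ^ S N / INR (fact (S N))))%R.
Proof.
  intros Hr; eapply Rle_trans; [apply Cexp_Taylor_bound|].
  pose proof (Cmod_ge_0 w) as H0; pose proof (INR_fact_lt_0 (S N)) as Hf.
  apply Rmult_le_compat_l; [lra|].
  apply Rmult_le_compat_r; [left; now apply Rinv_0_lt_compat|].
  apply Rmult_le_compat.
  - left; apply exp_pos.
  - apply pow_le; lra.
  - destruct Hr as [Hr|Hr]; [left; now apply exp_increasing|rewrite Hr; lra].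
  - apply pow_incr; lra.
Qed.

Lemma exp_Taylor_bound_lim (r : R) :
  is_lim_seq (fun N => 2 * (exp r * (2 * r) ^ S N / INR (fact (S N))))%R 0%R.
Proof.
  apply (is_lim_seq_ext (fun N => 2 * exp r * ((2 * r) ^ S N / INR (fact (S N))))%R).
  { intros N; unfold Rdiv; ring. }
  replace (Finite 0) with (Rbar_mult (2 * exp r)%R 0%R) by (simpl; f_equal; ring).
  apply is_lim_seq_scal_l.
  apply (is_lim_seq_incr_1 (fun N => (2 * r) ^ N / INR (fact N))%R).
  apply is_lim_seq_Reals, cv_speed_pow_fact.
Qed.

(** * Complex series and the exchange of summations *)

(** Neighbourhoods in [C_UniformSpace] are built from boxes; each contains a disc for [Cmod]. *)
Lemma C_filterlim_of_Cmod (u : nat -> C) (l : C) :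
  is_lim_seq (fun n => Cmod (u n - l)) 0%R ->
  filterlim u eventually (locally (T := C_UniformSpace) l).
Proof.
  intros H P HP.
  apply (locally_norm_le_locally (K := C_AbsRing) (V := C_NormedModule)) in HP.
  destruct HP as [eps Heps].
  apply is_lim_seq_spec in H; specialize (H eps); destruct H as [N HN].
  exists N; intros n Hn; apply Heps.
  specialize (HN n Hn); rewrite Rminus_0_r, Rabs_pos_eq in HN by apply Cmod_ge_0.
  exact HN.
Qed.

Lemma Cmod_is_series_le (a : nat -> C) (b : nat -> R) (la : C) (lb : R) :
  is_series (V := C_NormedModule) a la -> is_series b lb ->
  (forall n, Cmod (a n) <= b n)%R -> (Cmod la <= lb)%R.
Proof.
  intros Ha Hb Hab.
  apply (is_lim_seq_le (fun N => Cmod (sum_n a N)) (fun N => sum_n b N) (Cmod la) lb).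
  - intros N; eapply Rle_trans; [apply (norm_sum_n_m (V := C_NormedModule))|].
    apply sum_n_m_le; exact Hab.
  - exact (filterlim_comp _ _ _ _ _ _ _ _ Ha
      (filterlim_norm (V := C_NormedModule) la)).
  - exact Hb.
Qed.

Lemma is_series_Cmult_l (c : C) (a : nat -> C) (l : C) :
  is_series (V := C_NormedModule) a l ->
  is_series (V := C_NormedModule) (fun n => c * a n) (c * l).
Proof. exact (is_series_scal_l (V := C_NormedModule) c a l). Qed.

Lemma is_series_sum_n (f : nat -> nat -> C) (A : nat -> C) (N : nat) :
  (forall n, is_series (V := C_NormedModule) (fun m => f m n) (A n)) ->
  is_series (V := C_NormedModule) (fun m => sum_n (f m) N) (sum_n A N).
Proof.
  intros H; induction N as [|N IH].
  - rewrite sum_O; refine (is_series_ext _ _ _ _ (H 0%nat)).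
    intros m; now rewrite sum_O.
  - rewrite sum_Sn.
    refine (is_series_ext _ _ _ _ (is_series_plus _ _ _ _ IH (H (S N)))).
    intros m; now rewrite sum_Sn.
Qed.

(* The Taylor remainders of [Cexp (z m * t)] are bounded uniformly in [m], so the
   two summations can be exchanged. *)
Lemma is_series_Cexp_exchange (c z A : nat -> C) (b : nat -> R) (M : R) (t : C) :
  (forall m, Cmod (c m) <= b m)%R -> ex_series b ->
  (forall m, Cmod (z m) <= M)%R ->
  (forall n, is_series (V := C_NormedModule) (fun m => c m * z m ^ n) (A n)) ->
  exists S : C,
    is_series (V := C_NormedModule) (fun m => c m * Cexp (z m * t)) S /\
    is_series (V := C_NormedModule) (fun n => A n * (t ^ n / NtoC (fact n))) S.
Proof.
  intros Hc Hb Hz HA.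
  set (r := (M * Cmod t)%R).
  assert (Hr : forall m, (Cmod (z m * t) <= r)%R).
  { intros m; rewrite Cmod_mult; apply Rmult_le_compat_r; [apply Cmod_ge_0|apply Hz]. }
  (* Absolute convergence: all exponents lie in the disc of radius [r], so [exp r * b m]
     dominates. *)
  assert (Hex : ex_series (V := C_NormedModule) (fun m => c m * Cexp (z m * t))).
  { apply (ex_series_le (V := C_CompleteNormedModule) _ (fun m => exp r * b m)%R).
    - intros m; change (Cmod (c m * Cexp (z m * t)) <= exp r * b m)%R.
      rewrite Cmod_mult, Rmult_comm; apply Rmult_le_compat; try apply Cmod_ge_0; [|apply Hc].
      eapply Rle_trans; [apply Cmod_Cexp_le|].
      destruct (Hr m) as [H|H]; [left; now apply exp_increasing|rewrite H; lra].
    - apply (ex_series_scal_l (V := R_NormedModule)); exact Hb. }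
  destruct Hex as [S HS]; exists S; split; [exact HS|].
  apply C_filterlim_of_Cmod.
  destruct Hb as [B HB].
  (* [d N] is the Taylor remainder bound on the disc of radius [r]. The distance from the [N]-th
     partial sum to [S] is squeezed between 0 and [d N * B]. *)
  set (d := fun N => (2 * (exp r * (2 * r) ^ Datatypes.S N / INR (fact (Datatypes.S N))))%R).
  apply (is_lim_seq_le_le (fun _ => 0%R) _ (fun N => d N * B)%R).
  2: apply is_lim_seq_const.
  2: { replace (Finite 0) with (Rbar_mult 0%R B) by (simpl; f_equal; ring).
       apply is_lim_seq_scal_r, exp_Taylor_bound_lim. }
  intros N; split; [apply Cmod_ge_0|].
  (* A finite sum over [n] commutes with the series over [m], so the partial sum is itself a series
     with Taylor polynomials in place of exponentials. *)
  assert (HN : is_series (V := C_NormedModule)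
    (fun m => c m * Cexp_poly N (z m * t))
    (sum_n (fun n => A n * (t ^ n / NtoC (fact n))) N)).
  { refine (is_series_ext _ _ _ _
      (is_series_sum_n (fun m n => c m * z m ^ n * (t ^ n / NtoC (fact n))) _ N _)).
    - intros m; unfold Cexp_poly.
      rewrite <- (sum_n_mult_l (K := C_Ring)); apply sum_n_ext; intros n.
      rewrite Cpow_mult_l; unfold Cdiv; change (mult (K := C_Ring)) with Cmult.
      C_ring.
    - intros n; rewrite Cmult_comm.
      refine (is_series_ext _ _ _ _ (is_series_Cmult_l _ _ _ (HA n))).
      intros m; C_ring. }
  rewrite <- Cmod_opp, Copp_minus_distr.
  refine (Cmod_is_series_le _ (fun m => d N * b m)%R _ _
    (is_series_minus (V := C_NormedModule) _ _ _ _ HS HN)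
    (is_series_scal_l (V := R_NormedModule) (d N) _ _ HB) _).
  intros m.
  change (Cmod (c m * Cexp (z m * t) - c m * Cexp_poly N (z m * t)) <= d N * b m)%R.
  replace (c m * Cexp (z m * t) - c m * Cexp_poly N (z m * t))
    with ((Cexp (z m * t) - Cexp_poly N (z m * t)) * c m) by ring.
  rewrite Cmod_mult; apply Rmult_le_compat; try apply Cmod_ge_0; [|apply Hc].
  apply Cexp_poly_approx_bound, Hr.
Qed.

(** * Uniqueness of the generating function coefficients *)

Lemma sum_n_Re_Im (a : nat -> C) (N : nat) :
  sum_n a N = (sum_n (fun n => Re (a n)) N, sum_n (fun n => Im (a n)) N) :> C.
Proof.
  induction N as [|N IH].
  - rewrite !sum_O; now destruct (a 0%nat).
  - rewrite !sum_Sn, IH; reflexivity.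
Qed.

Lemma is_series_Re_Im (a : nat -> C) (l : C) :
  is_series (V := C_NormedModule) a l ->
  is_series (fun n => Re (a n)) (Re l) /\ is_series (fun n => Im (a n)) (Im l).
Proof.
  intros H; split; apply filterlim_locally; intros eps;
    pose proof (proj1 (filterlim_locally _ _) H eps) as [N HN];
    exists N; intros n Hn; specialize (HN n Hn); rewrite sum_n_Re_Im in HN;
    destruct HN as [H1 H2]; assumption.
Qed.

(** Convergence at [t = 1] makes the coefficients bounded, so the radius of convergence is at least
    1, and the identity theorem for real power series compares [a] with the zero sequence. *)
Lemma series_zero_coef_eq_0 (a : nat -> R) :
  (forall t : R, is_series (fun n => a n * t ^ n)%R 0%R) -> forall n, a n = 0%R.
Proof.
  intros H n.
  assert (Hr : Rbar_lt 0 (CV_radius a)).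
  { apply (Rbar_lt_le_trans 0 1%R); [simpl; lra|].
    apply CV_radius_bounded.
    destruct (filterlim_bounded (V := R_NormedModule) (fun n => a n * 1 ^ n)%R) as [M HM].
    - exists 0%R; apply (ex_series_lim_0 (fun n => a n * 1 ^ n)%R).
      eexists; apply H.
    - exists M; exact HM. }
  apply (PSeries_ext_recip a (fun _ => 0%R) n Hr).
  - rewrite CV_radius_const_0; easy.
  - apply filter_forall; intros t; rewrite PSeries_const_0.
    apply is_pseries_unique, is_pseries_R, H.
Qed.

(** Real [t] are enough: the differences [E n - F n], divided by [n!], are coefficients of a power
    series with sum 0, and its real and imaginary parts are real power series. *)
Lemma is_qEuler_unique (mu y : C) (E F : nat -> C) :
  is_qEuler mu y E -> is_qEuler mu y F -> forall n, E n = F n.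
Proof.
  intros HE HF.
  assert (H0 : forall t : R, is_series (V := C_NormedModule)
    (fun n => (E n - F n) / NtoC (fact n) * RtoC (t ^ n)) (RtoC 0)).
  { intros t.
    destruct (HE t) as [S [HS1 HS2]], (HF t) as [T [HT1 HT2]].
    assert (S = T) as -> by exact (filterlim_locally_unique _ _ _ HS1 HT1).
    replace (RtoC 0) with (plus (qnum mu 2 * T : C_NormedModule) (opp (qnum mu 2 * T)))
      by apply (plus_opp_r (G := C_AbelianGroup)).
    refine (is_series_ext _ _ _ _ (is_series_minus (V := C_NormedModule) _ _ _ _ HS2 HT2)).
    intros n; rewrite RtoC_pow; unfold Cdiv.
    change (plus (G := C_NormedModule)) with Cplus; change (opp (G := C_NormedModule)) with Copp.
    C_ring. }
  intros n.
  assert (HZ : (E n - F n) / NtoC (fact n) = 0).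
  { apply injective_projections.
    - apply (series_zero_coef_eq_0 (fun n => Re ((E n - F n) / NtoC (fact n)))); intros t.
      refine (is_series_ext _ _ _ _ (proj1 (is_series_Re_Im _ _ (H0 t)))).
      intros k; apply Re_mult_RtoC.
    - apply (series_zero_coef_eq_0 (fun n => Im ((E n - F n) / NtoC (fact n)))); intros t.
      refine (is_series_ext _ _ _ _ (proj2 (is_series_Re_Im _ _ (H0 t)))).
      intros k; apply Im_mult_RtoC. }
  assert (Hf : NtoC (fact n) <> 0) by apply NtoC_neq_0, fact_neq_0.
  replace (E n) with ((E n - F n) / NtoC (fact n) * NtoC (fact n) + F n) by (field; exact Hf).
  rewrite HZ; ring.
Qed.

(** * Powers of q and the series formula for the q-Euler polynomials *)

Lemma NtoC_plus (m n : nat) : NtoC (m + n) = NtoC m + NtoC n.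
Proof. unfold NtoC; now rewrite plus_INR, RtoC_plus. Qed.

Lemma NtoC_mult (m n : nat) : NtoC (m * n) = NtoC m * NtoC n.
Proof. unfold NtoC; now rewrite mult_INR, RtoC_mult. Qed.

Lemma qpow_plus (mu y z : C) : qpow mu (y + z) = qpow mu y * qpow mu z.
Proof. unfold qpow; rewrite <- Cexp_plus; f_equal; ring. Qed.

Lemma qpow_nat (mu : C) (m : nat) : qpow mu (NtoC m) = Cexp mu ^ m.
Proof.
  induction m as [|m IH].
  - unfold qpow, NtoC; simpl INR; now rewrite Cmult_0_r, Cexp_0.
  - rewrite <- (Nat.add_1_r m), NtoC_plus, qpow_plus, IH, Cpow_add_r, Cpow_1_r.
    unfold qpow, NtoC; simpl INR; now rewrite Cmult_1_r.
Qed.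

Lemma Cmod_sign (m : nat) : Cmod ((- (1)) ^ m) = 1%R.
Proof. now rewrite Cmod_pow, Cmod_m1, pow1. Qed.

(** Since powers of the base have modulus at most 1, the bound is independent of [m], as the
    exchange of summations requires. *)
Lemma Cmod_qnum_shift_le (mu y : C) (m : nat) : (Cmod (Cexp mu) < 1)%R ->
  (Cmod (qnum mu (NtoC m + y)) <= (1 + Cmod (qpow mu y)) * Cmod (/ (1 - Cexp mu)))%R.
Proof.
  intros Hmu; unfold qnum, Cdiv; rewrite Cmod_mult.
  apply Rmult_le_compat_r; [apply Cmod_ge_0|].
  eapply Rle_trans; [apply Cmod_triangle|].
  rewrite Cmod_1, Cmod_opp, qpow_plus, Cmod_mult, qpow_nat, Cmod_pow.
  apply Rplus_le_compat_l.
  rewrite <- (Rmult_1_l (Cmod (qpow mu y))) at 2.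
  apply Rmult_le_compat_r; [apply Cmod_ge_0|].
  rewrite <- (pow1 m); apply pow_incr; split; [apply Cmod_ge_0|lra].
Qed.

(** The exchange lemma is applied with weights (-1)^m q^m, dominated by a geometric series, and
    bounded nodes [m+y]_q. *)
Lemma qEuler_series (mu y : C) (n : nat) : (Cmod (Cexp mu) < 1)%R ->
  is_series (V := C_NormedModule)
    (fun m => qnum mu 2 *
       ((- (1)) ^ m * qpow mu (NtoC m) * qnum mu (NtoC m + y) ^ n))
    (qEuler mu n y).
Proof.
  intros Hmu.
  set (c := fun m => (- (1)) ^ m * qpow mu (NtoC m)).
  set (z := fun m => qnum mu (NtoC m + y)).
  set (M := ((1 + Cmod (qpow mu y)) * Cmod (/ (1 - Cexp mu)))%R).
  assert (Hz : forall m, (Cmod (z m) <= M)%R) by (intros m; now apply Cmod_qnum_shift_le).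
  assert (Hc : forall m, (Cmod (c m) <= Cmod (Cexp mu) ^ m)%R).
  { intros m; unfold c; rewrite Cmod_mult, Cmod_sign, qpow_nat, Cmod_pow; lra. }
  assert (Hb : ex_series (fun m => Cmod (Cexp mu) ^ m)%R).
  { eexists; apply is_series_geom; rewrite Rabs_pos_eq; [exact Hmu|apply Cmod_ge_0]. }
  assert (Hex : forall k, exists l,
    is_series (V := C_NormedModule) (fun m => c m * z m ^ k) l).
  { intros k; apply (ex_series_le (V := C_CompleteNormedModule) _
      (fun m => M ^ k * Cmod (Cexp mu) ^ m)%R).
    - intros m; change (Cmod (c m * z m ^ k) <= M ^ k * Cmod (Cexp mu) ^ m)%R.
      rewrite Cmod_mult, Rmult_comm, (Cmod_pow (z m)).
      apply Rmult_le_compat; [apply pow_le, Cmod_ge_0|apply Cmod_ge_0| |apply Hc].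
      apply pow_incr; split; [apply Cmod_ge_0|apply Hz].
    - apply (ex_series_scal_l (V := R_NormedModule)); exact Hb. }
  set (A := fun k => proj1_sig (constructive_indefinite_description _ (Hex k))).
  assert (HA : forall k, is_series (V := C_NormedModule) (fun m => c m * z m ^ k) (A k)).
  { intros k; exact (proj2_sig (constructive_indefinite_description _ (Hex k))). }
  assert (HE : is_qEuler mu y (fun k => qnum mu 2 * A k)).
  { intros t; destruct (is_series_Cexp_exchange c z A _ M t Hc Hb Hz HA) as [S [H1 H2]].
    exists S; split; [exact H1|].
    refine (is_series_ext _ _ _ _ (is_series_Cmult_l (qnum mu 2) _ _ H2)).
    intros k; apply Cmult_assoc. }
  (* The sequence just constructed shows that the specification behind [epsilon] is satisfiable;
     uniqueness then identifies the chosen sequence with it. *)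
  assert (Heq : qEuler mu n y = qnum mu 2 * A n).
  { refine (is_qEuler_unique mu y _ _ _ HE n).
    unfold qEuler; apply epsilon_spec; eexists; exact HE. }
  rewrite Heq; apply is_series_Cmult_l, HA.
Qed.

(** * Change of base, odd signs and sums in blocks *)

Lemma one_minus_Cexp_neq_0 (mu : C) : (Cmod (Cexp mu) < 1)%R -> 1 - Cexp mu <> 0.
Proof.
  intros H E.
  assert (Cexp mu = 1) as E1 by (replace (Cexp mu) with (1 - (1 - Cexp mu)) by ring; rewrite E; ring).
  rewrite E1, Cmod_1 in H; lra.
Qed.

Lemma Cexp_nat_mult (lam : C) (a : nat) : Cexp (NtoC a * lam) = Cexp lam ^ a.
Proof. rewrite <- qpow_nat; unfold qpow; f_equal; ring. Qed.

Lemma Cmod_Cexp_nat_mult_lt_1 (lam : C) (a : nat) :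
  (Cmod (Cexp lam) < 1)%R -> (0 < a)%nat -> (Cmod (Cexp (NtoC a * lam)) < 1)%R.
Proof.
  intros H Ha; rewrite Cexp_nat_mult, Cmod_pow.
  apply pow_lt_1_compat; [split; [apply Cmod_ge_0|exact H]|exact Ha].
Qed.

(** The numerator 1 - q^a of [a]_q cancels the denominator of the q-number in base q^a; it is
    nonzero because |q^a| < 1. *)
Lemma qnum_mult (lam y : C) (a : nat) :
  (Cmod (Cexp lam) < 1)%R -> (0 < a)%nat ->
  qnum lam (NtoC a) * qnum (NtoC a * lam) y = qnum lam (NtoC a * y).
Proof.
  intros H Ha; unfold qnum, qpow.
  replace (lam * NtoC a) with (NtoC a * lam) by ring.
  replace (lam * (NtoC a * y)) with (NtoC a * lam * y) by ring.
  field; split; apply one_minus_Cexp_neq_0; [exact H|].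
  now apply Cmod_Cexp_nat_mult_lt_1.
Qed.

Lemma sign_odd_mult (b i : nat) : (b mod 2 = 1)%nat -> (- (1)) ^ (b * i) = (- (1)) ^ i.
Proof.
  intros Hb; rewrite Cpow_mult_r, (Nat.div_mod_eq b 2), Hb, Cpow_add_r, Cpow_mult_r.
  replace ((- (1)) ^ 2) with (RtoC 1) by (simpl; ring).
  rewrite Cpow_1_l; f_equal; simpl; ring.
Qed.

(** [sum_n] includes its upper index, so [b * S N - 1] closes exactly [S N] blocks of length [b],
    and [b - 1] closes one block. *)
Lemma sum_n_blocks (f : nat -> C) (b N : nat) : (0 < b)%nat ->
  sum_n f (b * S N - 1) = sum_n (fun i => sum_n (fun l => f (b * i + l)%nat) (b - 1)) N.
Proof.
  intros Hb; destruct b as [|b]; [lia|].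
  assert (H : forall p k, sum_n f (p + S k) = sum_n f p + sum_n (fun l => f (S p + l)%nat) k).
  { intros p k; induction k as [|k IH].
    - rewrite sum_O, Nat.add_1_r, sum_Sn, Nat.add_0_r; reflexivity.
    - rewrite <- plus_n_Sm, sum_Sn, IH, (sum_Sn _ k).
      replace (S (p + S k)) with (S p + S k)%nat by lia.
      symmetry; apply Cplus_assoc. }
  replace (S b - 1)%nat with b by lia.
  induction N as [|N IH].
  - rewrite sum_O; replace (S b * 1 - 1)%nat with b by lia.
    apply sum_n_ext; intros l; f_equal; lia.
  - rewrite sum_Sn, <- IH.
    replace (S b * S (S N) - 1)%nat with ((S b * S N - 1) + S b)%nat by lia.
    rewrite H; apply (f_equal2 Cplus); [reflexivity|].
    apply sum_n_ext; intros l; f_equal; lia.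
Qed.

(** * The symmetric triple sum *)

(** Since a m + b j = [k], the power of q and the q-number depend on the indices only through [k].
    Both [k] and the sign exponent [i + l + j] are invariant under exchanging (a, j) with (b, l). *)
Lemma weighted_qEuler_term (lam x : C) (n a b i j l : nat) :
  (Cmod (Cexp lam) < 1)%R -> (0 < a)%nat -> (b mod 2 = 1)%nat ->
  let m := (b * i + l)%nat in
  let k := (a * b * i + a * l + b * j)%nat in
  qnum lam (NtoC a) ^ n * ((- (1)) ^ j * qpow lam (NtoC b * NtoC j) *
    ((- (1)) ^ m * qpow (NtoC a * lam) (NtoC m) *
      qnum (NtoC a * lam) (NtoC m + (NtoC b * x + NtoC b * NtoC j / NtoC a)) ^ n))
  = (- (1)) ^ (i + l + j) *
    (qpow lam (NtoC k) * qnum lam (NtoC a * NtoC b * x + NtoC k) ^ n).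
Proof.
  intros H Ha Hb m k.
  assert (Ek : NtoC k = NtoC b * NtoC j + NtoC a * NtoC m).
  { unfold k, m; rewrite !NtoC_plus, !NtoC_mult; ring. }
  replace (NtoC a * NtoC b * x + NtoC k)
    with (NtoC a * (NtoC m + (NtoC b * x + NtoC b * NtoC j / NtoC a)))
    by (rewrite Ek; field; apply NtoC_neq_0; lia).
  rewrite <- (qnum_mult lam _ a H Ha), Cpow_mult_l.
  replace (qpow (NtoC a * lam) (NtoC m)) with (qpow lam (NtoC a * NtoC m))
    by (unfold qpow; f_equal; ring).
  rewrite Ek, qpow_plus; unfold m.
  rewrite !Cpow_add_r, (sign_odd_mult b i Hb); ring.
Qed.

(** Stated as a limit over complete blocks: the sums over [l] and [j] stay finite, so the symmetry
    needs no rearrangement of infinite series. *)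
Lemma weighted_qEuler_sum_lim (lam x : C) (n a b : nat) :
  (Cmod (Cexp lam) < 1)%R -> (0 < a)%nat -> (0 < b)%nat -> (b mod 2 = 1)%nat ->
  filterlim (fun N => sum_n (fun i => sum_n (fun l => sum_n (fun j =>
      qnum (NtoC b * lam) 2 * qnum (NtoC a * lam) 2 * ((- (1)) ^ (i + l + j) *
      (qpow lam (NtoC (a * b * i + a * l + b * j)) *
       qnum lam (NtoC a * NtoC b * x + NtoC (a * b * i + a * l + b * j)) ^ n)))
    (a - 1)) (b - 1)) N)
  eventually (locally (T := C_UniformSpace)
    (qnum (NtoC b * lam) 2 * qnum lam (NtoC a) ^ n *
      sum_n (fun j : nat =>
        (- (1)) ^ j * qpow lam (NtoC b * NtoC j) *
        qEuler (NtoC a * lam) n (NtoC b * x + NtoC b * NtoC j / NtoC a)) (a - 1))).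
Proof.
  intros H Ha Hb0 Hb.
  set (p := qnum (NtoC b * lam) 2 * qnum lam (NtoC a) ^ n).
  set (y := fun j => NtoC b * x + NtoC b * NtoC j / NtoC a).
  set (w := fun j => (- (1)) ^ j * qpow lam (NtoC b * NtoC j)).
  set (T := fun m j => p * (w j * (qnum (NtoC a * lam) 2 *
    ((- (1)) ^ m * qpow (NtoC a * lam) (NtoC m) * qnum (NtoC a * lam) (NtoC m + y j) ^ n)))).
  assert (HS : is_series (V := C_NormedModule) (fun m => sum_n (T m) (a - 1))
    (p * sum_n (fun j => w j * qEuler (NtoC a * lam) n (y j)) (a - 1))).
  { rewrite <- (sum_n_mult_l (K := C_Ring)).
    apply is_series_sum_n; intros j; unfold T.
    apply is_series_Cmult_l, is_series_Cmult_l, qEuler_series.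
    now apply Cmod_Cexp_nat_mult_lt_1. }
  (* Partial sums of the series in [m] are taken along the subsequence of indices that end a
     block. *)
  refine (filterlim_ext _ _ _
    (filterlim_comp _ _ _ (fun N => (b * S N - 1)%nat) _ _ _ _ _ HS)).
  2: apply eventually_subseq; intros N; nia.
  intros N; rewrite sum_n_blocks by exact Hb0.
  apply sum_n_ext; intros i; apply sum_n_ext; intros l; apply sum_n_ext; intros j.
  rewrite <- (weighted_qEuler_term lam x n a b i j l H Ha Hb); cbv zeta.
  unfold T, p, w, y; C_ring.
Qed.

Theorem theorem2p2 (q lam : C) (Hlam : Cexp lam = q)
  (Hq : (0 < Cmod q < 1)%R)
  (n a b : nat) (Ha0 : (0 < a)%nat) (Hb0 : (0 < b)%nat)
  (Ha : (a mod 2 = 1)%nat) (Hb : (b mod 2 = 1)%nat) (x : C) :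
  qnum (NtoC b * lam) 2 * qnum lam (NtoC a) ^ n *
    sum_n (fun j : nat =>
      (- (1)) ^ j * qpow lam (NtoC b * NtoC j) *
      qEuler (NtoC a * lam) n (NtoC b * x + NtoC b * NtoC j / NtoC a)) (a - 1)
  =
  qnum (NtoC a * lam) 2 * qnum lam (NtoC b) ^ n *
    sum_n (fun j : nat =>
      (- (1)) ^ j * qpow lam (NtoC a * NtoC j) *
      qEuler (NtoC b * lam) n (NtoC a * x + NtoC a * NtoC j / NtoC b)) (b - 1).
Proof.
  assert (H : (Cmod (Cexp lam) < 1)%R) by (rewrite Hlam; apply Hq).
  (* Both sides are shown to be limits of one and the same sequence. *)
  refine (filterlim_locally_unique (V := C_NormedModule) _ _ _
    (weighted_qEuler_sum_lim lam x n a b H Ha0 Hb0 Hb) _).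
  refine (filterlim_ext _ _ _ (weighted_qEuler_sum_lim lam x n b a H Hb0 Ha0 Ha)).
  (* For fixed [i], swapping the two finite sums matches the index of range [a] with [j] and that of
     range [b] with [l]. *)
  intros N; apply sum_n_ext; intros i; rewrite sum_n_switch.
  apply sum_n_ext; intros l; apply sum_n_ext; intros j.
  replace (b * a * i + b * j + a * l)%nat with (a * b * i + a * l + b * j)%nat by ring.
  replace (i + j + l)%nat with (i + l + j)%nat by ring.
  rewrite (Cmult_comm (NtoC b) (NtoC a)), (Cmult_comm (qnum (NtoC a * lam) 2)).
  reflexivity.
Qed.
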